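(* Let $b\in\mathbb{R}$, $b\ne\pm1$, let $n\ge2$ be an integer, let $\mathbb{T}=\{z\in\mathbb{C}:|z|=1\}$, and let $w(z)=1/|z-b|$ for $z\in\mathbb{T}$. Any $n$-point weighted Fekete point set $\mathcal{F}_n^w$ for $w$ on $\mathbb{T}$ is the image of $n$ equally spaced points on $\mathbb{T}$ under the mapping $$\phi(u):=\frac{bu-1}{u-b},$$ i.e., it has the form $$\mathcal{F}_n^w=\{\zeta_1,\dots,\zeta_n\}=\left\{\phi\left(e^{i(\alpha+2\pi k/n)}\right):\ k=0,1,\ldots,n-1\right\},$$ where $\alpha\in[0,2\pi/n)$. Moreover, $$\delta_n^w(\mathbb{T})=\frac{n^{1/(n-1)}}{|1-b^2|}.$$
   Context: For a closed set $E\subset\mathbb{C}$, a continuous weight $w:E\to[0,\infty)$ and an integer $n\ge2$, the $n$th weighted diameter is $$\delta_n^w(E):=\sup_{Z_n\subset E}\left(\prod_{1\le j<k\le n}|z_j-z_k|\,w(z_j)w(z_k)\right)^{\frac{2}{n(n-1)}}=\sup_{Z_n\subset E}\left(|V(Z_n)|^{\frac{2}{n(n-1)}}\prod_{k=1}^n w(z_k)^{2/n}\right),$$ where the supremum is over all $n$-point sets $Z_n=\{z_k\}_{k=1}^n\subset E$ and $V(Z_n)=\prod_{1\le j<k\le n}(z_j-z_k)$. A set of $n$ points $\mathcal{F}_n^w\subset E$ that attains this supremum is called an ($n$th) weighted Fekete point set for $w$ on $E$. *)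

(* Defs.v *)
From mathcomp Require Import all_boot all_order all_algebra.
From mathcomp Require Import complex.
From mathcomp Require Import all_classical all_reals all_analysis.

Set Implicit Arguments.
Unset Strict Implicit.
Unset Printing Implicit Defensive.

Import Order.TTheory GRing.Theory Num.Theory.

Local Open Scope classical_set_scope.
Local Open Scope complex_scope.
Local Open Scope ring_scope.

(* The norm `|z| of the library lives in R[i]; cabs is its R-valued form. *)
Definition cabs (R : realType) (z : R[i]) : R := ComplexField.Normc.normc z.

Definition expi (R : realType) (t : R) : R[i] := cos t +i* sin t.

Definition unit_circle (R : realType) : set R[i] := [set z | cabs z = 1].
Arguments unit_circle : clear implicits.

(* An n-point set is given by an enumeration z : 'I_n -> R[i] of its points
   (injective, with values in E). *)
Definition npoints_in (R : realType) (n : nat) (E : set R[i])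
    (z : 'I_n -> R[i]) : Prop :=
  injective z /\ (forall i, E (z i)).

(* The value does not depend on the enumeration z of the set of points. *)
Definition weighted_mean (R : realType) (n : nat) (w : R[i] -> R)
    (z : 'I_n -> R[i]) : R :=
  (\prod_(j < n) \prod_(k < n | (j < k)%N)
     (cabs (z j - z k) * w (z j) * w (z k)))
  `^ (2 / (n%:R * (n%:R - 1))).

(* Extended-real-valued, so that an unbounded family really has supremum +oo.
   The weight is a total function, of which only the values on E are used. *)
Definition weighted_diameter (R : realType) (n : nat) (w : R[i] -> R)
    (E : set R[i]) : \bar R :=
  ereal_sup [set (weighted_mean w z)%:E | z in @npoints_in R n E].

Definition is_weighted_fekete (R : realType) (n : nat) (w : R[i] -> R)
    (E F : set R[i]) : Prop :=
  exists z : 'I_n -> R[i],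
    [/\ npoints_in E z, F = range z
      & (weighted_mean w z)%:E = weighted_diameter n w E].

(* Main.v *)
Require Import Defs.
From mathcomp Require Import all_boot all_order all_algebra.
From mathcomp Require Import complex.
From mathcomp Require Import all_classical all_reals all_analysis.
From mathcomp Require Import ring lra.

(** The Moebius map [phi] is an involution that preserves the unit circle (its
    coefficient [b] is real), and for points [z], [z'] of the circle
    [|z - z'| w(z) w(z') = |phi z - phi z'| / |1 - b ^ 2|] ([cabs_mobius_sub]).
    Hence [phi] turns the weighted problem into the classical unweighted one on
    the circle, and divides the mean of the distances by [|1 - b ^ 2|].

    In the unweighted problem, the product of the distances of [n] points [u i]
    of the circle is the modulus of a Vandermonde determinant with unimodular
    entries. Hadamard's inequality bounds its square by [n ^ n]
    ([leif_hadamard_unimodular]); raising to the power [1 / (n (n - 1))] gives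
    the value [n ^ (1 / (n - 1))]. Equality holds exactly when the rows are
    orthogonal, and the scalar products of the rows are geometric sums, so this
    means that all the [u i] have the same [n]-th power ([leif_vandermonde]).
    As [X ^ n - c] has at most [n] roots, such distinct points are [n] equally
    spaced points ([equal_powers_spaced]), and conversely equally spaced points
    have equal [n]-th powers ([spacedX]), so that the bound is attained.
    Applying [phi] again gives back the Fekete points. *)

Set Implicit Arguments.
Unset Strict Implicit.
Unset Printing Implicit Defensive.

Import Order.TTheory GRing.Theory Num.Theory.

Local Open Scope classical_set_scope.
Local Open Scope complex_scope.
Local Open Scope ring_scope.

(** * Hadamard's inequality for Vandermonde matrices on the circle *)

(** Hadamard's inequality with its equality case. The Gram matrix [G] of the
    rows is positive semidefinite and has all its diagonal entries equal to
    [n], so its eigenvalues are nonnegative and have mean [n]; their product is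
    [`|\det M| ^+ 2], and the arithmetic-geometric mean inequality bounds it by
    [n ^ n]. Equality holds when all eigenvalues are [n], and a diagonalizable
    matrix with the single eigenvalue [n] is scalar. *)
Lemma leif_hadamard_unimodular (C : numClosedFieldType) (n : nat)
    (M : 'M[C]_n) :
  (forall i j, `|M i j| = 1) ->
  `|\det M| ^+ 2 <= n%:R ^+ n ?= iff (M *m M^t*%sesqui == n%:R%:M).
Proof.
move=> M1; set G := M *m _.
have gramE (A : 'M[C]_n) i : (A *m A^t*%sesqui) i i = \sum_j `|A i j| ^+ 2.
  by rewrite !mxE; apply: eq_bigr => j _; rewrite !mxE normCK.
have adjM (A B : 'M[C]_n) : ((A *m B)^t* = B^t* *m A^t*)%sesqui.
  by rewrite trmx_mul map_mxM.
have detG : \det G = `|\det M| ^+ 2.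
  by rewrite det_mulmx det_map_mx det_tr normCK.
have trG : \tr G = n%:R * n%:R.
  rewrite /mxtrace (eq_bigr (fun=> n%:R)) => [|i _].
    by rewrite sumr_const card_ord mulr_natr.
  rewrite gramE (eq_bigr (fun=> 1)) => [|j _]; last by rewrite M1 expr1n.
  by rewrite sumr_const card_ord.
have G_normal : G \is normalmx.
  by apply/normalmxP; rewrite adjM trmxCK.
set P := spectralmx G; set s := spectral_diag G.
have P_unitary : P \is unitarymx := spectral_unitarymx G.
have P_unit := spectral_unit G.
have GE : G = invmx P *m diag_mx s *m P by apply/orthomx_spectralP.
have sE : diag_mx s = P *m M *m (P *m M)^t*%sesqui.
  rewrite adjM mulmxA -(mulmxA P M) -/G GE -invmx_unitary //.
  by rewrite !mulmxA mulmxV // mul1mx mulmxK.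
have s_ge0 i : 0 <= s 0 i.
  have -> : s 0 i = diag_mx s i i by rewrite mxE eqxx mulr1n.
  by rewrite sE gramE sumr_ge0 // => j _; rewrite exprn_ge0.
have det_s : \prod_i s 0 i = `|\det M| ^+ 2.
  rewrite -detG GE !det_mulmx det_inv det_diag mulrAC mulVf ?mul1r //.
  by rewrite -unitfE -unitmxE.
have tr_s : \sum_i s 0 i = n%:R * n%:R.
  by rewrite -trG GE mxtrace_mulC mulmxA mulmxV // mul1mx mxtrace_diag.
(* The mean of the eigenvalues is a quotient by [n], so [n = 0] is apart. *)
have [n0|n_gt0] := posnP n.
  have void (i : 'I_n) : False by have := ltn_ord i; rewrite [X in (_ < X)%N]n0.
  rewrite -det_s big1 => [|i]; last by case: (void i).
  have -> : n%:R ^+ n = 1 :> C by rewrite n0 expr0.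
  apply/leifP; case: ifPn => // /eqP [].
  by apply/matrixP => i; case: (void i).
have nN0 : n%:R != 0 :> C by rewrite pnatr_eq0 -lt0n.
have := @leif_AGM C 'I_n predT (fun i => s 0 i) (fun i _ => s_ge0 i).
rewrite /= card_ord tr_s det_s mulfK //; congr (Order.leif _ _ _).
apply/forall_inP/eqP => [s_eq|G_scalar i _].
  have s_cst i : s 0 i = n%:R.
    apply: (mulfI nN0); rewrite -tr_s (eq_bigr (fun=> s 0 i)) => [|j _].
      by rewrite sumr_const card_ord mulr_natl.
    by have /forall_inP /(_ j isT) /eqP := s_eq i isT.
  rewrite GE (_ : diag_mx s = n%:R%:M) ?mul_mx_scalar -?scalemxAl.
    by rewrite mulVmx // scalemx1.
  by apply/matrixP => i j; rewrite !mxE s_cst.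
suff s_cst j : s 0 j = n%:R by apply/forall_inP => j _; rewrite !s_cst.
have -> : s 0 j = diag_mx s j j by rewrite mxE eqxx mulr1n.
rewrite sE adjM mulmxA -(mulmxA P M) -/G G_scalar mul_mx_scalar -scalemxAl.
by rewrite (unitarymxP _) // scalemx1 mxE eqxx.
Qed.

Lemma conj_unimodular (C : numClosedFieldType) (x : C) :
  `|x| = 1 -> x^* = x^-1.
Proof. by move=> x1; rewrite invC_norm x1 expr1n invr1 mul1r. Qed.

(** Hadamard's inequality for the Vandermonde matrix whose rows are
    [(1, u i, ..., u i ^ (n - 1))]. As conjugation inverts [u j], the Gram
    matrix has the geometric sums of ratio [u i / u j] as entries; for distinct
    points such a sum vanishes exactly when [(u i / u j) ^ n = 1]. *)
Lemma leif_vandermonde (C : numClosedFieldType) (n : nat) (u : 'I_n -> C) :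
  injective u -> (forall i, `|u i| = 1) ->
  (\prod_(j < n) \prod_(k < n | (j < k)%N) `|u j - u k|) ^+ 2 <= n%:R ^+ n
    ?= iff [forall i, forall j, u i ^+ n == u j ^+ n].
Proof.
move=> u_inj u1; pose M := (Vandermonde n (\row_i u i))^T.
have ME i j : M i j = u i ^+ j by rewrite !mxE.
have u0 i : u i != 0 by rewrite -normr_eq0 u1 oner_eq0.
have -> : \prod_(j < n) \prod_(k < n | (j < k)%N) `|u j - u k| = `|\det M|.
  rewrite det_tr det_Vandermonde normr_prod; apply: eq_bigr => j _.
  by rewrite normr_prod; apply: eq_bigr => k _; rewrite !mxE distrC.
have := @leif_hadamard_unimodular C n M.
have M1 i j : `|M i j| = 1 by rewrite ME normrX u1 expr1n.
move=> /(_ M1); congr (Order.leif _ _ _).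
have gramE i j : (M *m M^t*%sesqui) i j = \sum_(k < n) (u i / u j) ^+ k.
  rewrite mxE; apply: eq_bigr => k _.
  rewrite [X in _ * X]mxE [X in _ * X^*]mxE !ME.
  by rewrite rmorphXn /= conj_unimodular // -exprMn.
have gram0 i j : i != j ->
    ((M *m M^t*%sesqui) i j == 0) = (u i ^+ n == u j ^+ n).
  move=> ij; have r1 : u i / u j - 1 != 0.
    rewrite subr_eq0; apply: contraNneq ij => /(congr1 ( *%R^~ (u j))).
    by rewrite divfK // mul1r => /u_inj ->.
  rewrite gramE -(inj_eq (mulfI r1)) -subrX1 mulr0 subr_eq0 exprMn exprVn.
  by rewrite -(inj_eq (mulIf (expf_neq0 n (u0 j)))) divfK ?expf_neq0 // mul1r.
apply/eqP/idP => [G_scalar|/forallP un].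
  apply/forallP => i; apply/forallP => j; have [->//|ij] := eqVneq i j.
  by rewrite -gram0 // G_scalar mxE (negbTE ij).
apply/matrixP => i j; rewrite [RHS]mxE; have [->|ij] := eqVneq i j.
  rewrite gramE divff // (eq_bigr (fun=> 1)) ?sumr_const ?card_ord //.
  by move=> k _; rewrite expr1n.
by apply/eqP; rewrite gram0 //; have /forallP := un i.
Qed.

Lemma normc_cabs (R : realType) (z : R[i]) : `|z| = (cabs z)%:C.
Proof. by []. Qed.

Lemma cabs_ge0 (R : realType) (z : R[i]) : 0 <= cabs z.
Proof. by rewrite -lecR -normc_cabs normr_ge0. Qed.

Lemma unit_circleP (R : realType) (z : R[i]) : unit_circle R z <-> `|z| = 1.
Proof. by rewrite normc_cabs; split => [->|/complexI]. Qed.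

(** The library norm of [R[i]] is complex-valued, while the weighted means are
    real: this is the Vandermonde bound read in [R]. *)
Lemma leif_vandermonde_cabs (R : realType) (n : nat) (u : 'I_n -> R[i]) :
  npoints_in (unit_circle R) u ->
  (\prod_(j < n) \prod_(k < n | (j < k)%N) cabs (u j - u k)) ^+ 2 <= n%:R ^+ n
    ?= iff [forall i, forall j, u i ^+ n == u j ^+ n].
Proof.
move=> [u_inj u_circ].
have u1 i : `|u i| = 1 by apply/unit_circleP.
set V := \prod_(j < n) _.
have [] := leif_vandermonde u_inj u1.
have -> : \prod_(j < n) \prod_(k < n | (j < k)%N) `|u j - u k| = V%:C.
  by rewrite rmorph_prod; apply: eq_bigr => j _; rewrite rmorph_prod.
have -> : V%:C ^+ 2 = (V ^+ 2)%:C by rewrite rmorphXn.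
have -> : n%:R ^+ n = (n%:R ^+ n)%:C :> R[i] by rewrite rmorphXn rmorph_nat.
by rewrite lecR (inj_eq (@complexI R)).
Qed.

(** * Equally spaced points on the circle *)

Lemma expiD (R : realType) (s t : R) : expi (s + t) = expi s * expi t.
Proof. by rewrite /expi cosD sinD [LHS]/=; congr (_ +i* _); rewrite addrC. Qed.

Lemma expi0 (R : realType) : expi (0 : R) = 1.
Proof. by rewrite /expi cos0 sin0. Qed.

Lemma expiMn (R : realType) (t : R) (n : nat) : expi (t *+ n) = expi t ^+ n.
Proof. by elim: n => [|n IH]; rewrite ?expi0 // mulrS expiD IH exprS. Qed.

Lemma expi_2pi_nat (R : realType) (m : nat) : expi (2 * pi * m%:R : R) = 1.
Proof.
rewrite mulr_natr expiMn (_ : expi _ = 1) ?expr1n //.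
by rewrite /expi mulr_natl cos2pi sin2pi.
Qed.

Lemma cabs_expi (R : realType) (t : R) : cabs (expi t) = 1.
Proof. by rewrite /cabs /= cos2Dsin2 sqrtr1. Qed.

Lemma expi_neq0 (R : realType) (t : R) : expi t != 0.
Proof. by rewrite -normr_eq0 normc_cabs cabs_expi oner_eq0. Qed.

(** By the half-angle formula [cos t = 1 - 2 sin (t / 2) ^ 2], and the sine of
    [t / 2] is positive because [0 < t / 2 < pi]. *)
Lemma expi_neq1 (R : realType) (t : R) : 0 < t < 2 * pi -> expi t != 1.
Proof.
move=> /andP[t0 t2]; apply/eqP => -[cos1 _]; move: cos1.
have s0 : 0 < sin (t / 2).
  by apply: sin_gt0_pi; rewrite divr_gt0 //= ltr_pdivrMr // mulrC.
rewrite (_ : t = t / 2 *+ 2); last by rewrite -mulr_natr divfK ?pnatr_eq0.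
rewrite cos_mulr2n cos2sin2; have := exprn_gt0 2 s0.
lra.
Qed.

(** The angle is taken nonnegative so that reducing it modulo a step only
    takes a natural number of steps. *)
Lemma expi_surj (R : realType) (z : R[i]) :
  unit_circle R z -> exists2 t, 0 <= t & z = expi t.
Proof.
case: z => x y /(congr1 (fun r => r ^+ 2)); rewrite /cabs /= expr1n.
rewrite sqr_sqrtr ?addr_ge0 ?sqr_ge0 // => xy1.
have x_itv : -1 <= x <= 1.
  rewrite -ler_norml -(ler_pXn2r (n := 2)) ?nnegrE // expr1n.
  by rewrite real_normK ?num_real // -xy1 lerDl sqr_ge0.
have cosx : cos (acos x) = x by apply: acosK; rewrite in_itv.
have sinx : sin (acos x) = `|y|.
  by rewrite sin_acos // -xy1 addrAC subrr add0r sqrtr_sqr.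
have [y0|/ltW y0] := leP 0 y.
  exists (acos x); first exact: acos_ge0.
  by rewrite /expi cosx sinx ger0_norm.
exists (- acos x + pi *+ 2).
  have := acos_lepi x_itv; have := @pi_ge0 R; rewrite mulr2n; lra.
by rewrite /expi cosD2pi sinD2pi cosN sinN cosx sinx ler0_norm // opprK.
Qed.

Lemma angle_mod_step (R : realType) (h t : R) : 0 < h -> 0 <= t ->
  exists2 a, 0 <= a < h & exists m : nat, t = a + h * m%:R.
Proof.
move=> h0 t0; have th0 : 0 <= t / h by rewrite divr_ge0 // ltW.
exists (t - h * (Num.truncn (t / h))%:R); last first.
  by exists (Num.truncn (t / h)); rewrite subrK.
have /andP[lo hi] := truncn_itv th0.
rewrite subr_ge0 ltrBlDr mulrC -ler_pdivlMr // lo /=.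
rewrite -[X in X + _]mul1r -mulrDl -ltr_pdivrMr // addrC.
by rewrite -[1]/(1%:R) -natrD addn1.
Qed.

Definition spaced (R : realType) (n : nat) (a : R) (k : 'I_n) : R[i] :=
  expi (a + 2 * pi * k%:R / n%:R).

Lemma spaced_npoints (R : realType) (n : nat) (a : R) :
  npoints_in (unit_circle R) (@spaced R n a).
Proof.
split=> [|k]; last exact: cabs_expi.
suff lt_neq (j k : 'I_n) : (j < k)%N -> spaced a j != spaced a k.
  move=> j k /eqP jk; have [/lt_neq||/ord_inj //] := ltngtP j k.
    by rewrite jk.
  by move=> /lt_neq; rewrite eq_sym jk.
move=> jk; have n0 : 0 < n%:R :> R by rewrite ltr0n (leq_trans _ (ltn_ord j)).
apply/eqP; rewrite /spaced => e.
have : expi (2 * pi * (k - j)%:R / n%:R : R) != 1.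
  apply: expi_neq1; rewrite divr_gt0 ?mulr_gt0 ?pi_gt0 ?ltr0n ?subn_gt0 //=.
  rewrite ltr_pdivrMr // ltr_pM2l ?mulr_gt0 ?pi_gt0 // ltr_nat.
    by rewrite (leq_ltn_trans (leq_subr _ _)).
  by rewrite (leq_ltn_trans _ (ltn_ord j)).
move/eqP; apply; apply: (mulfI (expi_neq0 (a + 2 * pi * j%:R / n%:R))).
rewrite mulr1 -expiD e; congr expi.
by rewrite natrB ?(ltnW jk) //; field; rewrite gt_eqF.
Qed.

Lemma spacedX (R : realType) (n : nat) (a : R) (k : 'I_n) :
  spaced a k ^+ n = expi a ^+ n.
Proof.
have nN0 : n%:R != 0 :> R.
  by rewrite pnatr_eq0 -lt0n (leq_trans _ (ltn_ord k)).
rewrite /spaced expiD exprMn -[X in _ * X]expiMn -[X in _ * expi X]mulr_natr.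
by rewrite divfK // expi_2pi_nat mulr1.
Qed.

(** A polynomial [X ^ n - c] has at most [n] roots, and the values of [e] are
    already [n] of them: a further root [u i] would be one too many. *)
Lemma all_nth_roots (F : fieldType) (n : nat) (c : F) (u e : 'I_n -> F) :
  injective e -> (forall i, u i ^+ n = c) -> (forall i, e i ^+ n = c) ->
  range u `<=` range e.
Proof.
move=> e_inj un en _ [i _ <-].
suff /codomP[k ->] : u i \in codom e by exists k.
have n0 : (0 < n)%N := leq_ltn_trans (leq0n i) (ltn_ord i).
apply: contraT => u_new.
have := @max_poly_roots _ ('X^n - c%:P) (u i :: codom e).
rewrite size_XnsubC //= size_codom card_ord ltnn u_new.
rewrite (map_inj_uniq e_inj) -size_poly_gt0 size_XnsubC // enum_uniq.
apply=> //; apply/andP; split.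
  by rewrite rootE !hornerE un subrr.
by apply/allP => _ /codomP[k ->]; rewrite rootE !hornerE en subrr.
Qed.

(** The common [n]-th power is that of [expi t], with [t] an angle of one of
    the points. Moving [t] by multiples of [2 pi / n] does not change it, so [t]
    can be replaced by its residue [a]; the [n] points spaced from [a] and the
    points [u i] are then two complete sets of [n]-th roots of one number. *)
Lemma equal_powers_spaced (R : realType) (n : nat) (u : 'I_n -> R[i]) :
  (0 < n)%N -> npoints_in (unit_circle R) u ->
  (forall i j, u i ^+ n = u j ^+ n) ->
  exists2 a, 0 <= a < 2 * pi / n%:R & range u = range (@spaced R n a).
Proof.
move=> n0 [u_inj u_circ] un; pose i0 := Ordinal n0.
have [t t0 ut] := expi_surj (u_circ i0).
have nR0 : 0 < n%:R :> R by rewrite ltr0n.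
have h0 : 0 < 2 * pi / n%:R :> R by rewrite divr_gt0 // mulr_gt0 // pi_gt0.
have [a a_itv [m tE]] := angle_mod_step h0 t0.
exists a => //.
have uE i : u i ^+ n = expi a ^+ n.
  rewrite (un i i0) ut tE expiD exprMn -[X in _ * X]expiMn.
  rewrite -[X in _ * expi X]mulr_natr mulrAC divfK ?gt_eqF //.
  by rewrite expi_2pi_nat mulr1.
have [e_inj _] := spaced_npoints n a.
have eX (k : 'I_n) : spaced a k ^+ n = expi a ^+ n := spacedX a k.
apply/seteqP; split; first exact: all_nth_roots e_inj uE eX.
exact: all_nth_roots u_inj eX uE.
Qed.

(** * The Moebius map and the weighted mean *)

Definition mobius (F : fieldType) (b u : F) : F := (b * u - 1) / (u - b).

(** The matrix [[b, -1], [1, -b]] of this homography has determinant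
    [1 - b ^ 2], whence the factor. *)
Lemma mobius_sub (F : fieldType) (b u v : F) : u != b -> v != b ->
  mobius b u - mobius b v = (1 - b ^+ 2) * (u - v) / ((u - b) * (v - b)).
Proof. by move=> ub vb; rewrite /mobius; field; rewrite !subr_eq0 ub vb. Qed.

(** The matrix of this homography has square [(b ^ 2 - 1) I]. *)
Lemma mobius_involutive (F : fieldType) (b u : F) : b ^+ 2 != 1 -> u != b ->
  mobius b (mobius b u) = u.
Proof.
move=> b2 ub; rewrite /mobius; field; rewrite subr_eq0 ub /=.
have -> : b * u - 1 + - b * (u - b) = b ^+ 2 - 1 by ring.
by rewrite subr_eq0.
Qed.

(** For [|u| = 1], [|b u - 1| = |u| |b - 1 / u|], and [1 / u] is the conjugate
    of [u]: as [b] is real, this is [|b - u|]. *)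
Lemma unit_circle_mobius (R : realType) (b : R) (u : R[i]) : u != b%:C ->
  unit_circle R u -> unit_circle R (mobius b%:C u).
Proof.
move=> ub u1; rewrite /unit_circle /= /mobius /cabs.
rewrite ComplexField.Normc.normcM ComplexField.Normc.normcV.
suff -> : ComplexField.Normc.normc (b%:C * u - 1) =
          ComplexField.Normc.normc (u - b%:C).
  apply: divff; apply: contra_neq ub => /ComplexField.Normc.eq0_normc/eqP.
  by rewrite subr_eq0 => /eqP.
case: u u1 {ub} => x y /(congr1 (fun r => r ^+ 2)); rewrite /cabs /= expr1n.
rewrite sqr_sqrtr ?addr_ge0 ?sqr_ge0 // => xy1.
have y2 : y ^+ 2 = 1 - x ^+ 2 by rewrite -xy1 addrAC subrr add0r.
congr Num.sqrt; ring: y2.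
Qed.

(** The square saves halving the number [n * n.-1] of ordered pairs. *)
Lemma prod_pairs_const (R : comPzRingType) (n : nat) (c : R) :
  (\prod_(j < n) \prod_(k < n | (j < k)%N) c) ^+ 2 = c ^+ (n * n.-1).
Proof.
rewrite (exchange_big_dep predT) //=.
rewrite (eq_bigr (fun k : 'I_n => c ^+ k)) => [|k _].
  rewrite prodrXr -(big_mkord xpredT (fun i => i)).
  rewrite bin2_sum -exprM.
  by case: n => // n; rewrite mulnC -mul_bin_diag bin1.
by rewrite -(big_ord_widen n (fun=> c)) ?prodr_const ?card_ord // ltnW.
Qed.

Lemma sqrb_neq1 (R : realType) (b : R) :
  b <> 1 -> b <> -1 -> 1 - b ^+ 2 != 0.
Proof.
move=> b_neq1 b_neqN1; rewrite -[1](expr1n _ 2) subr_sqr.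
rewrite mulf_neq0 ?subr_eq0 ?addr_eq0 //.
  by rewrite eq_sym; apply/eqP.
by rewrite eq_sym eqr_oppLR; apply/eqP.
Qed.

Lemma sqrb_neq1C (R : realType) (b : R) :
  b <> 1 -> b <> -1 -> b%:C ^+ 2 != 1.
Proof.
move=> b_neq1 b_neqN1; have := sqrb_neq1 b_neq1 b_neqN1.
by rewrite subr_eq0 eq_sym -(inj_eq (@complexI R)) rmorphXn.
Qed.

Lemma unit_circle_neq (R : realType) (b : R) (z : R[i]) :
  b <> 1 -> b <> -1 -> unit_circle R z -> z != b%:C.
Proof.
move=> b_neq1 b_neqN1 z1; apply/eqP => zb.
have := sqrb_neq1 b_neq1 b_neqN1; rewrite subr_eq0 => /eqP; apply.
move: z1; rewrite zb /unit_circle /= /cabs /= expr0n addr0 sqrtr_sqr => b1.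
by rewrite -[RHS]real_normK ?num_real // b1 expr1n.
Qed.

(** The weight is made for this: a weighted distance is, up to the constant
    [|1 - b ^ 2|], the distance of the images under the Moebius map. *)
Lemma cabs_mobius_sub (R : realType) (b : R) (u v : R[i]) :
  b <> 1 -> b <> -1 -> unit_circle R u -> unit_circle R v ->
  cabs (u - v) * (1 / cabs (u - b%:C)) * (1 / cabs (v - b%:C)) =
  cabs (mobius b%:C u - mobius b%:C v) / `|1 - b ^+ 2|.
Proof.
move=> b_neq1 b_neqN1 u1 v1.
have ub := unit_circle_neq b_neq1 b_neqN1 u1.
have vb := unit_circle_neq b_neq1 b_neqN1 v1.
rewrite mobius_sub // /cabs !ComplexField.Normc.normcM.
rewrite ComplexField.Normc.normcV ComplexField.Normc.normcM !div1r.
have -> : ComplexField.Normc.normc (1 - b%:C ^+ 2) = `|1 - b ^+ 2|.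
  rewrite -(rmorph1 (real_complex R)) -rmorphXn -rmorphB /=.
  by rewrite expr0n addr0 sqrtr_sqr.
have nz (z : R[i]) : z != b%:C -> ComplexField.Normc.normc (z - b%:C) != 0.
  apply: contra_neq => /ComplexField.Normc.eq0_normc/eqP.
  by rewrite subr_eq0 => /eqP.
by field; rewrite normr_eq0 sqrb_neq1 // !nz.
Qed.

Lemma npoints_mobius (R : realType) (b : R) (n : nat) (z : 'I_n -> R[i]) :
  b <> 1 -> b <> -1 -> npoints_in (unit_circle R) z ->
  npoints_in (unit_circle R) (fun i => mobius b%:C (z i)).
Proof.
move=> b_neq1 b_neqN1 [z_inj z1].
have zb i := unit_circle_neq b_neq1 b_neqN1 (z1 i).
split=> [i j|i]; last exact: unit_circle_mobius.
move=> /(congr1 (mobius b%:C)).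
by rewrite !mobius_involutive ?sqrb_neq1C // => /z_inj.
Qed.

(** By [cabs_mobius_sub] the weighted mean of [z] is the unweighted mean of its
    image, divided by [|1 - b ^ 2|]: each of the [n (n - 1) / 2] pairs gives
    one factor, and the exponent is [2 / (n (n - 1))]. Since powers with a
    positive exponent are strictly increasing, the Vandermonde bound carries
    over together with its equality case. *)
Lemma leif_weighted_mean (R : realType) (b : R) (n : nat) (z : 'I_n -> R[i]) :
  b <> 1 -> b <> -1 -> (2 <= n)%N ->
  npoints_in (unit_circle R) z ->
  weighted_mean (fun z => 1 / cabs (z - b%:C)) z
    <= n%:R `^ (1 / (n%:R - 1)) / `|1 - b ^+ 2|
    ?= iff [forall i, forall j,
              mobius b%:C (z i) ^+ n == mobius b%:C (z j) ^+ n].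
Proof.
move=> b_neq1 b_neqN1 n2 z_in; have [z_inj z1] := z_in.
set d := `|1 - b ^+ 2|; have d0 : 0 < d by rewrite normr_gt0 sqrb_neq1.
set u := fun i => mobius b%:C (z i).
pose V := \prod_(j < n) \prod_(k < n | (j < k)%N) cabs (u j - u k).
have V0 : 0 <= V.
  by apply: prodr_ge0 => j _; apply: prodr_ge0 => k _; exact: cabs_ge0.
pose N : R := n%:R * (n%:R - 1).
have NE : N = (n * n.-1)%:R by rewrite /N natrM -subn1 natrB // ltnW.
have N0 : 0 < N by rewrite NE ltr0n muln_gt0 -subn1 subn_gt0 n2 ltnW.
have nR0 : n%:R != 0 :> R by rewrite pnatr_eq0 -lt0n ltnW.
have n1R0 : n%:R - 1 != 0 :> R by rewrite subr_eq0 pnatr_eq1 gtn_eqF.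
have meanE : weighted_mean (fun z => 1 / cabs (z - b%:C)) z =
    (V ^+ 2) `^ N^-1 / d.
  rewrite /weighted_mean -/N.
  rewrite (eq_bigr (fun j : 'I_n =>
             (\prod_(k < n | (j < k)%N) cabs (u j - u k)) *
             \prod_(k < n | (j < k)%N) d^-1)) => [|j _]; last first.
    by rewrite -big_split; apply: eq_bigr => k _; exact: cabs_mobius_sub.
  rewrite big_split -/V /= powRrM [X in X `^ N^-1]powR_mulrn; last first.
    rewrite mulr_ge0 // prodr_ge0 // => j _; rewrite prodr_ge0 // => k _.
    by rewrite invr_ge0 ltW.
  rewrite exprMn prod_pairs_const.
  rewrite powRM ?sqr_ge0 ?exprn_ge0 ?invr_ge0 ?(ltW d0) //.
  congr (_ * _); rewrite -powR_mulrn ?invr_ge0 ?(ltW d0) // -NE -powRrM.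
  by rewrite mulfV ?gt_eqF // powRr1 // invr_ge0 ltW.
have boundE : n%:R `^ (1 / (n%:R - 1)) = (n%:R ^+ n) `^ N^-1 :> R.
  rewrite -powR_mulrn ?ler0n // -powRrM; congr (_ `^ _); rewrite /N.
  by field; rewrite nR0 n1R0.
rewrite meanE boundE.
have [le eq] := leif_vandermonde_cabs (npoints_mobius b_neq1 b_neqN1 z_in).
have Ninv0 : 0 < N^-1 by rewrite invr_gt0.
split.
  rewrite ler_pM2r ?invr_gt0 // ge0_ler_powR ?(ltW Ninv0) // nnegrE ?sqr_ge0 //.
rewrite -eq (inj_eq (mulIf (invr_neq0 (lt0r_neq0 d0)))).
apply/eqP/eqP => [|-> //]; apply: (powR_injective Ninv0).
  by rewrite nnegrE exprn_ge0.
by rewrite nnegrE exprn_ge0.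
Qed.

Theorem theorem3p1 (R : realType) (b : R) (n : nat)
    (b_neq1 : b <> 1) (b_neqN1 : b <> -1) (n_ge2 : (2 <= n)%N) :
  let w : R[i] -> R := fun z => 1 / cabs (z - b%:C) in
  let phi : R[i] -> R[i] := fun u => (b%:C * u - 1) / (u - b%:C) in
  (forall F : set R[i], is_weighted_fekete n w (unit_circle R) F ->
     exists alpha : R, 0 <= alpha < 2 * pi / n%:R /\
       F = [set phi (expi (alpha + 2 * pi * k%:R / n%:R)) | k in `I_n]) /\
  weighted_diameter n w (unit_circle R) =
    (n%:R `^ (1 / (n%:R - 1)) / `|1 - b ^+ 2|)%:E.
Proof.
move=> w phi.
have phiK z : unit_circle R z -> phi (phi z) = z.
  move=> z1; apply: mobius_involutive; last exact: unit_circle_neq.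
  exact: sqrb_neq1C.
have diamE : weighted_diameter n w (unit_circle R) =
    (n%:R `^ (1 / (n%:R - 1)) / `|1 - b ^+ 2|)%:E.
  apply/eqP; rewrite eq_le; apply/andP; split.
    apply: ge_ereal_sup => _ [z z_in <-]; rewrite lee_fin.
    exact: leif_weighted_mean.
  (* The bound is attained at the image of the [n]-th roots of unity. *)
  have e_in := spaced_npoints n (0 : R).
  have e'_in := npoints_mobius b_neq1 b_neqN1 e_in.
  apply: ereal_sup_ubound; exists (fun k => phi (spaced 0 k)).
    exact: e'_in.
  congr (_%:E); apply/eqP.
  rewrite (leif_weighted_mean b_neq1 b_neqN1 n_ge2 e'_in).
  apply/forallP => i; apply/forallP => j.
  rewrite -[mobius _ _]/(phi (phi _)) -[X in _ == X ^+ n]/(phi (phi _)).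
  by rewrite !phiK ?spacedX //; exact: e_in.2.
split=> // F [z [z_in -> meanE]].
have [z_inj z1] := z_in.
move: meanE; rewrite diamE => -[/eqP].
rewrite (leif_weighted_mean b_neq1 b_neqN1 n_ge2 z_in) => /forallP zn.
have [a a_itv aE] := equal_powers_spaced (ltnW n_ge2)
    (npoints_mobius b_neq1 b_neqN1 z_in)
    (fun i j => eqP (forallP (zn i) j)).
exists a; split=> //.
have -> : range z = phi @` range (fun i => mobius b%:C (z i)).
  rewrite image_comp; apply: eq_imagel => i _.
  by rewrite -[RHS]/(phi (phi _)) phiK.
rewrite aE; apply/seteqP; split.
  by move=> _ [_ [k _ <-] <-]; exists k => //=.
move=> _ [k /= kn <-]; exists (spaced a (Ordinal kn)) => //.
by exists (Ordinal kn).
Qed.
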